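(* Let $d,n\ge 1$, let $x_1,\dots,x_n\in\mathbb{R}^d$, and let $X=\{\lVert x_i-x_j\rVert : 1\le i,j\le n\}$. If $|X|\ge 4$, where $|X|$ is the cardinality of $X$, then the 2-RBF mixed kernel Gaussian process regression model is identifiable. That is, for all $\theta_{ij}=(\sigma_{ij},l_{ij})$ with $\sigma_{ij},l_{ij}>0$ ($i,j\in\{1,2\}$), $l_{11}<l_{12}$ and $l_{21}<l_{22}$, if $$G_{RBF}(\theta_{11})+G_{RBF}(\theta_{12})=G_{RBF}(\theta_{21})+G_{RBF}(\theta_{22}),$$ then $\theta_{11}=\theta_{21}$ and $\theta_{12}=\theta_{22}$.
   Context: For $\theta=(\sigma,l)$ with $\sigma,l>0$, the radial basis function (RBF) kernel on $\mathbb{R}^d$ is $K_{RBF}(x,x';\theta)=\sigma^2\exp\left(-\frac{\lVert x-x'\rVert^2}{l^2}\right)$, where $\lVert\cdot\rVert$ is the Euclidean norm. Given points $x_1,\dots,x_n\in\mathbb{R}^d$, the $n\times n$ kernel matrix is $G_{RBF}(\theta)=[K_{RBF}(x_i,x_j;\theta)]_{i,j}$. The 2-RBF mixed kernel model is $y=f_1(x)+f_2(x)+\epsilon$ with $f_1\sim GP(0,K_{RBF}(\cdot,\cdot;\theta_1))$, $f_2\sim GP(0,K_{RBF}(\cdot,\cdot;\theta_2))$, $\epsilon\sim N(0,\sigma_0^2)$, where the two kernels are distinguished by requiring $l_1<l_2$ for $\theta_1=(\sigma_1,l_1)$, $\theta_2=(\sigma_2,l_2)$; it is called identifiable if $\theta_1,\theta_2$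 are uniquely determined by the matrix $G_{RBF}(\theta_1)+G_{RBF}(\theta_2)$. *)

(* Defs.v *)
From HB Require Import structures.
From mathcomp Require Import all_boot all_order all_algebra finmap.
From mathcomp Require Import reals sequences.

Set Implicit Arguments.
Unset Strict Implicit.
Unset Printing Implicit Defensive.

Import Order.TTheory GRing.Theory Num.Theory.

Local Open Scope ring_scope.

(* The library norm `|v| on row vectors is the sup norm. *)
Definition enorm (R : realType) (d : nat) (v : 'rV[R]_d) : R :=
  Num.sqrt (\sum_(k < d) v ord0 k ^+ 2).

(* A parameter theta = (sigma, l) is a pair of reals. *)
Definition sigma (R : realType) (theta : R * R) : R := theta.1.
Definition len (R : realType) (theta : R * R) : R := theta.2.

Definition rbf_param (R : realType) (theta : R * R) : Prop :=
  0 < sigma theta /\ 0 < len theta.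

Definition K_RBF (R : realType) (d : nat) (u v : 'rV[R]_d) (theta : R * R) : R :=
  sigma theta ^+ 2 * expR (- (enorm (u - v) ^+ 2 / len theta ^+ 2)).

Definition G_RBF (R : realType) (d n : nat) (x : 'I_n -> 'rV[R]_d)
    (theta : R * R) : 'M[R]_n :=
  \matrix_(i < n, j < n) K_RBF (x i) (x j) theta.

Definition distances (R : realType) (d n : nat) (x : 'I_n -> 'rV[R]_d) :
    {fset R} :=
  [fset enorm (x i - x j) | i in 'I_n, j in 'I_n]%fset.

(* The two kernels of a model are told apart by the order of their lengths. *)
Definition identifiable_2RBF (R : realType) (d n : nat)
    (x : 'I_n -> 'rV[R]_d) : Prop :=
  forall theta11 theta12 theta21 theta22 : R * R,
    rbf_param theta11 -> rbf_param theta12 ->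
    rbf_param theta21 -> rbf_param theta22 ->
    len theta11 < len theta12 -> len theta21 < len theta22 ->
    G_RBF x theta11 + G_RBF x theta12 = G_RBF x theta21 + G_RBF x theta22 ->
    theta11 = theta21 /\ theta12 = theta22.

(* Main.v *)
(** Squared distances turn the equality of the kernel matrices into a vanishing
    exponential sum with at most four distinct exponents [- l^-2], known to
    vanish at four distinct points. Exponentials with distinct exponents form a
    Chebyshev system (dividing by one exponential and differentiating removes a
    term and, by Rolle, at most one zero), so all coefficients vanish, and the
    ordering of the lengths forces the parameters to agree. *)
Require Import Defs.
From mathcomp Require Import all_boot all_order all_algebra finmap.
From mathcomp Require Import reals sequences exp.
From mathcomp Require Import lra.
From mathcomp Require Import boolp normedtype derive realfun.

Set Implicit Arguments.
Unset Strict Implicit.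
Unset Printing Implicit Defensive.

Import Order.TTheory GRing.Theory Num.Theory numFieldNormedType.Exports.

Local Open Scope ring_scope.

(** Rolle yields a zero of [g] in each gap between consecutive zeros of [f]. Zeros are kept as
    strictly increasing paths so that those found in different gaps are distinct and can be counted
    by [size]. *)
Lemma Rolle_path (R : realType) (f g : R -> R) (x : R) (z : seq R) :
  (forall t : R, is_derive t 1 f (g t)) ->
  path <%R x z -> {in x :: z, forall t, f t = 0} ->
  exists2 w, path <%R x w &
    size w = size z /\ {in w, forall t, g t = 0}.
Proof.
move=> df; elim: z x => [|y z IH] x /=; first by exists [::].
move=> /andP[xy yz] f0.
have [w yw [sw gw]] : exists2 w, path <%R y w &
    size w = size z /\ {in w, forall t, g t = 0}.
  by apply: IH => // t tz; apply: f0; rewrite inE tz orbT.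
have dv t : derivable f t 1 by have [] := df t.
have [c cxy dc] : exists2 c, c \in `]x, y[ & is_derive c 1 f 0.
  apply: Rolle => //.
    by apply: derivable_within_continuous => t _.
  by rewrite !f0 // !inE eqxx ?orbT.
move: cxy; rewrite in_itv /= => /andP[xc cy].
exists (c :: w) => /=.
  by rewrite xc; apply: path_le cy yw; exact: lt_trans.
split=> [|t]; first by rewrite sw.
rewrite inE => /predU1P[->|/gw //].
by have [_ <-] := df c; have [_ ->] := dc.
Qed.

Definition expsum (R : realType) (s : seq R) (c : R -> R) (t : R) : R :=
  \sum_(b <- s) c b * expR (b * t).

(** Shifting every exponent by [a] makes the term of exponent [a] constant, so its coefficient in
    the derivative is zero. *)
Lemma is_derive_expsum (R : realType) (s : seq R) (c : R -> R) (a t : R) :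
  is_derive t 1 (fun u => \sum_(b <- s) c b * expR ((b - a) * u))
    (\sum_(b <- s) c b * (b - a) * expR ((b - a) * t)).
Proof.
elim: s => [|b s IH].
  rewrite big_nil.
  under eq_fun do rewrite big_nil.
  exact: is_derive_cst.
rewrite big_cons.
under eq_fun do rewrite big_cons.
apply: is_deriveD.
have d1 : is_derive t 1 (fun u : R => (b - a) * u) (b - a).
  have := @is_deriveZ _ _ _ id (b - a) t 1 1 (is_derive_id _ _).
  by rewrite /GRing.scale /= mulr1.
have d2 := is_derive1_comp (is_derive_expR ((b - a) * t)) d1.
have := is_deriveZ (c b) d2.
by rewrite /GRing.scale /= -mulrA [expR _ * _]mulrC.
Qed.

Lemma expsum_mulexp (R : realType) (s : seq R) (c : R -> R) (a t : R) :
  \sum_(b <- s) c b * expR ((b - a) * t) = expsum s c t * expR (- (a * t)).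
Proof.
rewrite mulr_suml; apply: eq_bigr => b _.
by rewrite -mulrA -expRD mulrBl.
Qed.

Lemma expsum_eq0 (R : realType) (s z : seq R) (c : R -> R) :
  uniq s -> sorted <%R z -> (size s <= size z)%N ->
  {in z, forall t, expsum s c t = 0} -> {in s, forall b, c b = 0}.
Proof.
elim: s z c => [//|a s IH] [//|x z] c /= /andP[as_ us] xz; rewrite ltnS => sz F0.
have G0 : {in x :: z, forall t,
    \sum_(b <- a :: s) c b * expR ((b - a) * t) = 0}.
  by move=> t tz; rewrite expsum_mulexp F0 ?mul0r.
have [w xw [sw w0]] := Rolle_path (is_derive_expsum (a :: s) c a) xz G0.
have cs : {in s, forall b, c b = 0}.
  move=> b bs.
  have /eqP : c b * (b - a) = 0.
    (* The derivative has lost the term of [a]; up to a positive factor it is the sum over [s] with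
       these coefficients, and it vanishes on [w], which is one shorter than [x :: z]. *)
    apply: (IH w (fun b => c b * (b - a))) => //; rewrite ?sw ?(path_sorted xw)//.
    move=> t /w0 /eqP; rewrite big_cons subrr mulr0 mul0r add0r.
    rewrite (expsum_mulexp s (fun b => c b * (b - a))).
    by rewrite mulf_eq0 (gt_eqF (expR_gt0 _)) orbF => /eqP.
  rewrite mulf_eq0 subr_eq0 => /orP[/eqP//|/eqP ba].
  by move: as_; rewrite -ba bs.
(* Only the term of [a] survives, so a single zero [x] settles its coefficient. *)
move=> b; rewrite inE => /predU1P[->|/cs//].
have /eqP := F0 x (mem_head _ _).
rewrite /expsum big_cons big1_seq ?addr0; last first.
  by move=> i /andP[_ /cs ->]; rewrite mul0r.
by rewrite mulf_eq0 (gt_eqF (expR_gt0 _)) orbF => /eqP.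
Qed.

Lemma expsum_delta (R : realType) (s : seq R) (a e t : R) :
  uniq s -> e \in s ->
  expsum s (fun b => a *+ (b == e)) t = a * expR (e * t).
Proof.
move=> us es; rewrite /expsum (bigD1_seq e) //= eqxx mulr1n big1 ?addr0 //.
by move=> i /negbTE ->; rewrite mul0r.
Qed.

Lemma expsum2_inj (R : realType) (z : seq R)
    (a1 a2 a3 a4 e1 e2 e3 e4 : R) :
  0 < a1 -> 0 < a2 -> 0 < a3 -> 0 < a4 -> e1 < e2 -> e3 < e4 ->
  uniq z -> (4 <= size z)%N ->
  {in z, forall t, a1 * expR (e1 * t) + a2 * expR (e2 * t) =
                   a3 * expR (e3 * t) + a4 * expR (e4 * t)} ->
  [/\ a1 = a3, a2 = a4, e1 = e3 & e2 = e4].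
Proof.
move=> a1p a2p a3p a4p e12 e34 uz sz E.
(* Exponents of the two sides may coincide, so [c] collects the net coefficient at each distinct
   exponent. *)
pose s := undup [:: e1; e2; e3; e4].
pose c b := a1 *+ (b == e1) + a2 *+ (b == e2) -
  (a3 *+ (b == e3) + a4 *+ (b == e4)).
have us : uniq s by exact: undup_uniq.
have c0 : {in s, forall b, c b = 0}.
  apply: (@expsum_eq0 _ s (sort <=%R z)) => //.
  - by rewrite sort_lt_sorted.
  - by rewrite size_sort (leq_trans (size_undup _)).
  move=> t; rewrite mem_sort => /E Et.
  have -> : expsum s c t = expsum s (fun b => a1 *+ (b == e1)) t +
      expsum s (fun b => a2 *+ (b == e2)) t -
      (expsum s (fun b => a3 *+ (b == e3)) t +
       expsum s (fun b => a4 *+ (b == e4)) t).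
    rewrite /expsum -!big_split -sumrB /=.
    by apply: eq_bigr => b _; rewrite /c -!mulrDl -mulrBl.
  rewrite !expsum_delta // ?mem_undup ?inE ?eqxx ?orbT //.
  by rewrite Et subrr.
have {us c0} [] : [/\ c e1 = 0, c e2 = 0, c e3 = 0 & c e4 = 0].
  by split; apply: c0; rewrite mem_undup !inE eqxx ?orbT.
rewrite /c !eqxx !(eq_sym e3) !(eq_sym e4) !(eq_sym e2 e1) (lt_eqF e12).
rewrite [e3 == e4](lt_eqF e34).
(* An exponent without a partner on the other side would have a nonzero net coefficient, by
   positivity. The orderings exclude the crossed matching, leaving [e1 = e3] and [e2 = e4]. *)
case: (eqVneq e1 e3) => h13; case: (eqVneq e1 e4) => h14;
case: (eqVneq e2 e3) => h23; case: (eqVneq e2 e4) => h24;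
rewrite ?mulr1n ?mulr0n => q1 q2 q3 q4; split => //; lra.
Qed.

Lemma expsum_len_lt (R : realType) (l l' : R) : 0 < l -> l < l' ->
  - (l ^+ 2)^-1 < - (l' ^+ 2)^-1.
Proof.
move=> l0 ll'; have l'0 := lt_trans l0 ll'.
by rewrite ltrN2 ltf_pV2 ?posrE ?exprn_gt0 // ltr_pXn2r // nnegrE ltW.
Qed.

Theorem theorem2 (R : realType) (d n : nat) (x : 'I_n -> 'rV[R]_d)
    (hd : (1 <= d)%N) (hn : (1 <= n)%N)
    (hX : (4 <= #|` distances x|)%N) :
  identifiable_2RBF x.
Proof.
move=> [s1 l1] [s2 l2] [s3 l3] [s4 l4]; rewrite /rbf_param /sigma /len /=.
move=> [s1p l1p] [s2p l2p] [s3p l3p] [s4p l4p] l12 l34 EG.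
(* The kernel is exponential in the squared distance. Squaring is injective on nonnegative reals, so
   no points are lost. *)
pose z := [seq r ^+ 2 | r <- (distances x : seq R)].
have dP r : r \in distances x -> exists i j, r = enorm (x i - x j).
  by case/imfset2P => i _ [j _ ->]; exists i, j.
have uz : uniq z.
  rewrite map_inj_in_uniq ?fset_uniq // => r r' /dP[i [j ->]] /dP[i' [j' ->]].
  by move/eqP; rewrite eqrXn2 ?sqrtr_ge0 // => /eqP.
have [] := @expsum2_inj R z (s1 ^+ 2) (s2 ^+ 2) (s3 ^+ 2) (s4 ^+ 2)
  (- (l1 ^+ 2)^-1) (- (l2 ^+ 2)^-1) (- (l3 ^+ 2)^-1) (- (l4 ^+ 2)^-1);
  rewrite ?exprn_gt0 ?expsum_len_lt ?size_map //.
  move=> t /mapP[r /dP[i [j ->]] ->].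
  have := congr1 (fun M : 'M_n => M i j) EG.
  rewrite !mxE /K_RBF /sigma /len /=.
  by rewrite !mulNr ![(l1 ^+ 2)^-1 * _]mulrC ![_^-1 * _]mulrC.
have pos_inj (u v : R) : 0 < u -> 0 < v -> u ^+ 2 = v ^+ 2 -> u = v.
  by move=> /ltW u0 /ltW v0 /eqP; rewrite eqrXn2 // => /eqP.
move=> /pos_inj -> // /pos_inj -> // /oppr_inj/invr_inj/pos_inj -> //.
by move=> /oppr_inj/invr_inj/pos_inj -> //.
Qed.
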